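(* Let $k\ge3$, and suppose $B\in\mathcal{S}(T_k)$ has spectrum $\{\lambda_1^{(3k+2)},\lambda_2^{(3k-2)},\lambda_3^{(3k-3)},\lambda_4^{(2)},\lambda_5^{(2)},\lambda_6^{(1)},\lambda_7^{(1)},\lambda_8^{(1)}\}$, where $\lambda_1,\dots,\lambda_8$ are distinct. Then $\lambda_1+3\lambda_2+3\lambda_3=2\lambda_4+2\lambda_5+\lambda_6+\lambda_7+\lambda_8$.
   Context: For a graph $G$ on $n$ vertices, $\mathcal{S}(G)$ is the set of real symmetric $n\times n$ matrices $A=[a_{ij}]$ with $a_{ij}\ne0$ iff $ij\in E(G)$ for $i\ne j$ (diagonal unrestricted). The notation $\{\mu_1^{(m_1)},\dots,\mu_q^{(m_q)}\}$ for a spectrum means the distinct eigenvalues are $\mu_1,\dots,\mu_q$ with multiplicities $m_1,\dots,m_q$. For a positive integer $k$, $T_k$ is the tree obtained from one star $K_{1,3}$ and $3k$ further copies of $K_{1,3}$ by identifying each pendant vertex of the initial $K_{1,3}$ with a pendant vertex of $k$ of the copies (so $T_k$ has $9k+4$ vertices: a central vertex, its $3$ neighbors, $3k$ vertices at distance $2$, and $6k$ leaves at distance $3$). *)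

(* Defs.v *)
From mathcomp Require Import all_boot all_order all_algebra.
From mathcomp Require Import reals.

Set Implicit Arguments.
Unset Strict Implicit.
Unset Printing Implicit Defensive.

Import Order.TTheory GRing.Theory Num.Theory.

Local Open Scope ring_scope.

(* The class S(G), for the simple graph G with finite vertex type V and       *)
(* edge relation e.  Rows and columns are indexed by vertices through the     *)
(* bijection enum_rank : V -> 'I_#|V|.  Diagonal entries are unrestricted.    *)
Definition graph_matrix (R : realType) (V : finType) (e : rel V)
    (A : 'M[R]_#|V|) : Prop :=
  A^T = A /\
  forall u v : V, u != v -> (A (enum_rank u) (enum_rank v) != 0) = e u v.

(* has_spectrum A [:: (mu_1, m_1); ...; (mu_q, m_q)]: the distinct            *)
(* eigenvalues of A are mu_1, ..., mu_q, with algebraic multiplicities        *)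
(* m_1, ..., m_q.  For real symmetric A these are also the geometric          *)
(* multiplicities, and all complex eigenvalues are real.                      *)
Definition has_spectrum (R : realType) (n : nat) (A : 'M[R]_n)
    (s : seq (R * nat)) : Prop :=
  [/\ uniq [seq p.1 | p <- s],
      forall x : R, eigenvalue A x = (x \in [seq p.1 | p <- s])
    & forall p, p \in s -> mup p.1 (char_poly A) = p.2].

(* Vertices of T_k, by distance to the central vertex: the central vertex,    *)
(* the pendant vertices i of the initial star, the centres (i, j) of the      *)
(* copies of K_{1,3} (copy j being glued at i), and the two pendant vertices  *)
(* (i, j, l) of copy (i, j) that are not identified with i.                   *)
Definition T_vertex (k : nat) : finType :=
  ((unit + 'I_3) + ('I_3 * 'I_k + 'I_3 * 'I_k * 'I_2))%type.

Definition T_child (k : nat) (u v : T_vertex k) : bool :=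
  match u, v with
  | inl (inl _), inl (inr _) => true
  | inl (inr i), inr (inl p) => p.1 == i
  | inr (inl p), inr (inr q) => q.1 == p
  | _, _ => false
  end.

Definition T_edge (k : nat) : rel (T_vertex k) :=
  fun u v => T_child u v || T_child v u.

Lemma T_edge_sym (k : nat) : symmetric (@T_edge k).
Proof. by move=> u v; rewrite /T_edge orbC. Qed.

Lemma T_edge_irr (k : nat) : irreflexive (@T_edge k).
Proof. by case=> [[]|[]]. Qed.

Lemma card_T_vertex (k : nat) : #|T_vertex k| = (9 * k + 4)%N.
Proof.
rewrite !card_sum !card_prod !card_ord card_unit.
by rewrite -mulnA (mulnC k) mulnA -mulnDl addnC.
Qed.

(* Main.v *)
(* Multiplicities are bounded above by zero forcing: if an eigenfunction that
   vanishes on a set Z of vertices must vanish everywhere, the eigenspace has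
   dimension at most #|Z|.  The multiplicity 3k+2 of l1 is the largest possible,
   and a leaf, or a neighbour of the centre, with diagonal entry other than l1
   would allow a forcing set of 3k+1 vertices; so all of these entries are l1.
   Next, the multiplicities of l2 and l3 force both to be eigenvalues of the
   3 x 3 block of each copy of K_{1,3} with its glued vertex deleted, whose
   third eigenvalue is l1, and force l2 to be the entry at the centre.  Hence each
   remaining diagonal entry is l2 + l3 - l1, and the relation is the equality of
   the trace of B with the sum of its eigenvalues. *)
Require Import Defs.
From mathcomp Require Import all_boot all_order all_algebra.
From mathcomp Require Import reals.
From mathcomp Require Import ring lra zify.

Set Implicit Arguments.
Unset Strict Implicit.
Unset Printing Implicit Defensive.

Import Order.TTheory GRing.Theory Num.Theory.

Local Open Scope ring_scope.

(** * Multiplicities and trace of real symmetric matrices *)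

(** [P (X - A) = (X - D) P], and [\det P] cancels. The sizes agree only propositionally so that [P]
    can stack bases whose heights are two ranks. *)
Lemma char_poly_similar (F : fieldType) (m n : nat) (P : 'M[F]_(m, n))
    (A : 'M[F]_n) (D : 'M[F]_m) :
  m = n -> row_free P -> P *m A = D *m P -> char_poly A = char_poly D.
Proof.
move=> emn; case: n / emn in P A *; rewrite row_free_unit => Punit PA.
have detP : \det (map_mx polyC P) != 0.
  by rewrite det_map_mx polyC_eq0 -unitfE -unitmxE.
apply: (mulfI detP); rewrite [RHS]mulrC /char_poly -!det_mulmx.
congr (\det _); rewrite /char_poly_mx mulmxBr mulmxBl -!map_mxM PA.
by rewrite mul_mx_scalar mul_scalar_mx.
Qed.

Lemma dotmx_eq0 (R : realDomainType) (n : nat) (v : 'rV[R]_n) :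
  v *m v^T = 0 -> v = 0.
Proof.
move=> /matrixP/(_ 0 0); rewrite !mxE => /eqP.
under eq_bigr do rewrite mxE -expr2.
rewrite psumr_eq0 => [/allP v0|i _]; last exact: sqr_ge0.
apply/rowP => i; rewrite mxE; apply/eqP; rewrite -sqrf_eq0.
by apply: (implyP (v0 i _)); rewrite ?mem_index_enum.
Qed.

(* The row space of A - a is an invariant complement of the eigenspace, on
   which a is not an eigenvalue. *)
Lemma mup_char_poly_sym (R : realFieldType) (n : nat) (A : 'M[R]_n) (a : R) :
  A^T = A -> mup a (char_poly A) = \rank (eigenspace A a).
Proof.
move=> symA; rewrite /eigenspace; set N := A - a%:M.
have symN : N^T = N by rewrite /N linearB /= symA tr_scalar_mx.
have NA : N *m A = A *m N.
  by rewrite /N mulmxBl mulmxBr mul_mx_scalar mul_scalar_mx.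
set E := row_base (kermx N); set F := row_base N.
have EA : E *m A = a *: E by apply/eigenspaceP; rewrite eq_row_base.
have FA_F : (F *m A <= F)%MS.
  rewrite (eqmxMr A (eq_row_base N)) NA eq_row_base; exact: submxMl.
set D := F *m A *m pinvmx F.
have DF : D *m F = F *m A by rewrite mulmxKpV.
(* For symmetric [N], kernel and row space meet trivially: [v = w N] and [v N = 0] give
   [v v^T = v N w^T = 0], applied row by row. *)
have ker_im m (v : 'M_(m, n)) : (v <= kermx N)%MS -> (v <= N)%MS -> v = 0.
  move=> /sub_kermxP vN /submxP[w ew].
  apply/row_matrixP => i; rewrite row0; apply: dotmx_eq0.
  by rewrite {2}ew row_mul trmx_mul symN mulmxA -row_mul vN row0 mul0mx.
have S_free : row_free (col_mx E F).
  apply: inj_row_free => v; rewrite -[v]hsubmxK mul_row_col => /eqP.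
  set v1 := lsubmx v; set v2 := rsubmx v; rewrite addr_eq0 => /eqP e.
  have v1E : v1 *m E = 0.
    apply: ker_im; first by rewrite (submx_trans (submxMl _ _)) ?eq_row_base.
    by rewrite e eqmx_opp (submx_trans (submxMl _ _)) ?eq_row_base.
  move/eqP: e; rewrite v1E eq_sym oppr_eq0 => /eqP v2F.
  suff [-> ->] : v1 = 0 /\ v2 = 0 by rewrite row_mx0.
  split; apply: (row_free_inj (row_base_free _)); rewrite mul0mx //; done.
have dimS : (\rank (kermx N) + \rank N)%N = n.
  by rewrite mxrank_ker subnK ?rank_leq_row.
rewrite (char_poly_similar (D := block_mx a%:M 0 0 D) dimS S_free); last first.
  by rewrite mul_col_mx mul_block_col !mul0mx addr0 add0r DF EA mul_scalar_mx.
(* The block [D] contributes no root [a]: [F] would carry an eigenvector of [D] for [a] into both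
   the kernel and the row space of [N]. *)
rewrite /char_poly char_block_diag_mx det_ublock mupMl; last first.
  rewrite -/(char_poly D) -eigenvalue_root_char; apply/eigenvalueP => -[v vD].
  apply/negP; rewrite negbK; apply/eqP.
  apply: (row_free_inj (row_base_free N)); rewrite mul0mx; apply: ker_im.
    apply/eigenspaceP; rewrite -mulmxA -/F -DF mulmxA vD -scalemxAl; done.
  by rewrite (submx_trans (submxMl _ _)) ?eq_row_base.
by rewrite /char_poly_mx map_scalar_mx -raddfB /= det_scalar mup_XsubCX eqxx.
Qed.

Lemma dvdp_prod_XsubCX (F : fieldType) (s : seq (F * nat)) (q : {poly F}) :
    q != 0 -> uniq [seq p.1 | p <- s] ->
    (forall p, p \in s -> mup p.1 q = p.2) ->
  \prod_(p <- s) ('X - p.1%:P) ^+ p.2 %| q.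
Proof.
move=> q0; elim: s => [|p s IHs] /=; first by rewrite big_nil dvd1p.
case/andP=> ps us mups; rewrite big_cons Gauss_dvdp.
  rewrite -mup_geq // (mups p) ?mem_head ?leqnn // IHs // => r rs.
  by apply: mups; rewrite inE rs orbT.
apply: coprimep_expl; rewrite coprimep_sym coprimep_XsubC; apply: contra ps.
rewrite rootE horner_prod prodf_seq_eq0 => /hasP[r rs /=].
rewrite horner_exp expf_eq0 hornerXsubC subr_eq0 => /andP[_ /eqP->].
exact: map_f.
Qed.

(** The product of the prescribed linear factors divides the characteristic polynomial; both are
    monic of degree [n], hence equal, and the trace is minus the coefficient of degree [n - 1]. *)
Lemma trace_spectrum (R : realType) (n : nat) (A : 'M[R]_n)
    (s : seq (R * nat)) :
    (0 < n)%N -> has_spectrum A s -> \sum_(p <- s) p.2 = n ->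
  \tr A = \sum_(p <- s) p.1 *+ p.2.
Proof.
move=> n0 [us _ mups] es; have A0 := monic_neq0 (char_poly_monic A).
pose t := flatten [seq nseq p.2 p.1 | p <- s].
have prodt : \prod_(p <- s) ('X - p.1%:P) ^+ p.2 = \prod_(x <- t) ('X - x%:P).
  rewrite /t big_flatten big_map; apply: eq_bigr => p _.
  by rewrite big_nseq -Monoid.iteropE.
have sizet : size t = n.
  rewrite -es /t size_flatten /shape -map_comp sumnE big_map.
  by apply: eq_bigr => p _; rewrite /= size_nseq.
have := dvdp_prod_XsubCX A0 us mups; rewrite prodt => dvdt.
have eqt : \prod_(x <- t) ('X - x%:P) = char_poly A.
  apply/eqP; rewrite -eqp_monic ?monic_prod_XsubC ?char_poly_monic //.
  by rewrite -dvdp_size_eqp // size_prod_XsubC sizet size_char_poly.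
apply: oppr_inj; rewrite -char_poly_trace // -eqt -sizet coefPn_prod_XsubC.
  congr (- _); rewrite /t big_flatten big_map; apply: eq_bigr => p _.
  by rewrite big_nseq -Monoid.iteropE.
by rewrite sizet -lt0n.
Qed.

(** * Eigenfunctions and zero forcing *)

(** Row vectors of [eigenspace A a] read as functions on the vertices; [f = 0] is allowed. *)
Definition eigenfun (R : realType) (V : finType) (A : 'M[R]_#|V|) (a : R)
    (f : V -> R) : Prop :=
  forall v, \sum_u f u * A (enum_rank u) (enum_rank v) = a * f v.

(** Restriction to [Z] is a linear map into a space of dimension [size Z], and the forcing
    hypothesis makes it injective on the eigenspace. The matrix [M] below performs this
    restriction. *)
Lemma rank_eigenspace_forcing (R : realType) (V : finType) (A : 'M[R]_#|V|)
    (a : R) (Z : seq V) :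
    (forall f, eigenfun A a f -> {in Z, forall z, f z = 0} ->
       forall v, f v = 0) ->
  (\rank (eigenspace A a) <= size Z)%N.
Proof.
move=> force; set E := row_base (eigenspace A a).
have EA : E *m A = a *: E by apply/eigenspaceP; rewrite eq_row_base.
pose M : 'M[R]_(#|V|, size Z) :=
  \matrix_(i, j) (i == enum_rank (tnth (in_tuple Z) j))%:R.
suff /eqP <- : row_free (E *m M) by exact: rank_leq_col.
apply: inj_row_free => u; rewrite mulmxA => uEM.
apply: (row_free_inj (row_base_free _)); rewrite mul0mx -/E.
have xA : (u *m E) *m A = a *: (u *m E) by rewrite -mulmxA EA -scalemxAr.
move: (u *m E) uEM xA => x xM xA.
pose f v := x 0 (enum_rank v).
suff f0 v : f v = 0.
  by apply/rowP => i; rewrite mxE -(f0 (enum_val i)) /f enum_valK.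
apply: (force f _ _ v) => [{}v|z].
  move/rowP/(_ (enum_rank v)): xA; rewrite !mxE => <-.
  by rewrite (reindex enum_rank) //; apply/onW_bij/enum_rank_bij.
move=> /(tnthP (in_tuple Z))[j ->]; move/rowP/(_ j): xM; rewrite !mxE => <-.
rewrite (bigD1 (enum_rank (tnth (in_tuple Z) j))) //= !mxE eqxx mulr1.
by rewrite big1 ?addr0 // => i /negPf ni; rewrite !mxE ni mulr0.
Qed.

Section Forcing.

Context (R : realType) (V : finType) (e : rel V) (A : 'M[R]_#|V|).
Context (hA : graph_matrix e A) (a : R) (f : V -> R) (hf : eigenfun A a f).

Let A_edge u v : u != v -> e u v -> A (enum_rank u) (enum_rank v) != 0.
Proof. by case: hA => _ h uv; rewrite h. Qed.

Let A_nonedge u v : u != v -> ~~ e u v -> A (enum_rank u) (enum_rank v) = 0.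
Proof. by case: hA => _ h uv; rewrite -h // negbK => /eqP. Qed.

(** The colour-change rule: the eigenvalue equation at [v] reduces to [f u] times a nonzero edge
    entry. *)
Lemma eigenfun_force (v u : V) :
    u != v -> e u v -> f v = 0 ->
    (forall w, w != u -> e w v -> f w = 0) ->
  f u = 0.
Proof.
move=> uv euv fv nb; apply/eqP; have := hf v.
rewrite fv mulr0 (bigD1 u) //= big1 ?addr0 => [|w wu].
  by move/eqP; rewrite mulf_eq0 (negPf (A_edge uv euv)) orbF.
have [->|wv] := eqVneq w v; first by rewrite fv mul0r.
have [ewv|newv] := boolP (e w v); first by rewrite nb ?mul0r.
by rewrite A_nonedge ?mulr0.
Qed.

(** The equation at [v] reduces to [(A v v - a) * f v = 0]. *)
Lemma eigenfun_force_self (v : V) :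
    A (enum_rank v) (enum_rank v) != a ->
    (forall w, e w v -> f w = 0) ->
  f v = 0.
Proof.
move=> Av nb; apply/eqP; have := hf v.
rewrite (bigD1 v) //= big1 ?addr0 => [|w wv].
  move/eqP; rewrite mulrC -subr_eq0 -mulrBl mulf_eq0 subr_eq0.
  by rewrite (negPf Av).
have [ewv|newv] := boolP (e w v); first by rewrite nb ?mul0r.
by rewrite A_nonedge ?mulr0.
Qed.

End Forcing.

(** * Forcing rules in $T_k$, with [Tc], [Tv], [Tw], [Tx] at distance 0, 1, 2, 3 from the centre *)

Definition Tc k : T_vertex k := inl (inl tt).
Definition Tv k (i : 'I_3) : T_vertex k := inl (inr i).
Definition Tw k (p : 'I_3 * 'I_k) : T_vertex k := inr (inl p).
Definition Tx k (q : 'I_3 * 'I_k * 'I_2) : T_vertex k := inr (inr q).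

Lemma T_sum (R : realType) (k : nat) (F : T_vertex k -> R) :
  \sum_u F u = F (Tc k) + \sum_i F (Tv k i) +
               (\sum_p F (Tw p) + \sum_q F (Tx q)).
Proof.
rewrite big_sumType; congr (_ + _); first rewrite big_sumType; last first.
  by rewrite big_sumType.
by congr (_ + _); rewrite (bigD1 tt) //= big1 ?addr0 // => -[].
Qed.

Section Tree.

Context (R : realType) (k : nat) (B : 'M[R]_#|T_vertex k|).
Context (hB : graph_matrix (@T_edge k) B).

Let b (u v : T_vertex k) : R := B (enum_rank u) (enum_rank v).

Section Eigenfunction.

Context (a : R) (f : T_vertex k -> R) (hf : eigenfun B a f).

Let force := eigenfun_force hB hf.

Lemma force_w_of_x q : f (Tx q) = 0 -> f (Tw q.1) = 0.
Proof.
move=> fx; apply: (force (v := Tx q)) => //; first by rewrite /T_edge /= eqxx.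
move=> [[[]|i]|[p|q']] //= pq; rewrite /T_edge /= ?orbF // => /eqP qp.
by case/eqP: pq; rewrite qp.
Qed.

Lemma force_c_of_v i :
  f (Tv k i) = 0 -> (forall j, f (Tw (i, j)) = 0) -> f (Tc k) = 0.
Proof.
move=> fv fw; apply: (force (v := Tv k i)) => //.
move=> [[[]|i']|[[i' j]|q']] //= _; rewrite /T_edge /= ?orbF // => /eqP ->.
exact: fw.
Qed.

Lemma force_w_of_v i j :
    f (Tv k i) = 0 -> f (Tc k) = 0 ->
    (forall j', j' != j -> f (Tw (i, j')) = 0) ->
  f (Tw (i, j)) = 0.
Proof.
move=> fv fc fw; apply: (force (v := Tv k i)) => //.
  by rewrite /T_edge /= eqxx.
move=> [[[]|i']|[[i' j']|q']] //= ne; rewrite /T_edge /= ?orbF // => /eqP ei.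
by subst i'; apply: fw; apply: contraNneq ne => ->.
Qed.

Lemma force_v_of_w p :
    f (Tw p) = 0 -> (forall l, f (Tx (p, l)) = 0) -> f (Tv k p.1) = 0.
Proof.
move=> fw fx; apply: (force (v := Tw p)) => //.
  by rewrite /T_edge /= eqxx.
move=> [[[]|i']|[p'|[p' l]]] //= ne; rewrite /T_edge /= ?orbF // => /eqP ei.
  by case/eqP: ne; rewrite ei.
by rewrite ei; apply: fx.
Qed.

Lemma force_x_of_w p l l' :
    f (Tw p) = 0 -> f (Tv k p.1) = 0 -> f (Tx (p, l')) = 0 ->
  f (Tx (p, l)) = 0.
Proof.
move=> fw fv fx; have [->//|ll'] := eqVneq l l'.
apply: (force (v := Tw p)) => //.
  by rewrite /T_edge /= eqxx.
move=> [[[]|i']|[p'|[p' l'']]] //= ne; rewrite /T_edge /= ?orbF // => /eqP ei.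
  by rewrite -ei.
have nl : l'' != l by apply: contraNneq ne => ->; rewrite ei.
suff el : l'' = l' by rewrite ei el.
apply: val_inj; move: ll' nl; rewrite -!val_eqE /=.
move: (ltn_ord l) (ltn_ord l') (ltn_ord l''); lia.
Qed.

Lemma force_v_of_c i i0 i1 :
    i0 != i1 -> f (Tc k) = 0 -> f (Tv k i0) = 0 -> f (Tv k i1) = 0 ->
  f (Tv k i) = 0.
Proof.
move=> i01 fc f0 f1.
have [->//|ii0] := eqVneq i i0; have [->//|ii1] := eqVneq i i1.
apply: (force (v := Tc k)) => //.
move=> [[[]|i']|[p'|q]] //= ne; rewrite /T_edge /= ?orbF // => _.
have ni : i' != i by apply: contraNneq ne => ->.
have [->|->] // : i' = i0 \/ i' = i1.
have [->|n0] := eqVneq i' i0; first by left.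
right; apply: val_inj; move: i01 ii0 ii1 ni n0; rewrite -!val_eqE /=.
move: (ltn_ord i) (ltn_ord i') (ltn_ord i0) (ltn_ord i1); lia.
Qed.

(** Last stage of both arguments on the diagonal: [Tv k i0] forces the centre, the centre forces the
    third branch vertex, and each [Tw p] forces its remaining leaf. *)
Lemma eigenfun_eq0_of_w i0 i1 :
    i0 != i1 -> (forall p, f (Tw p) = 0) ->
    (forall p, exists l, f (Tx (p, l)) = 0) ->
    f (Tv k i0) = 0 -> f (Tv k i1) = 0 ->
  forall v, f v = 0.
Proof.
move=> i01 fw fx f0 f1; have fc : f (Tc k) = 0 by apply: (force_c_of_v f0).
have fv i : f (Tv k i) = 0 by apply: (force_v_of_c _ i01).
case=> [[[]|i]|[p|[p l]]] //; first exact: fv; first exact: fw.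
by have [l' fl'] := fx p; apply: (force_x_of_w l _ _ fl').
Qed.

End Eigenfunction.

(** * Diagonal entries fixed by the largest multiplicity *)

Lemma leaf_diag (a : R) :
  (3 * k + 1 < \rank (eigenspace B a))%N -> forall q, b (Tx q) (Tx q) = a.
Proof.
move=> rk [[i0 j0] l0]; apply/eqP/contraT => xa.
(* [Z] takes one leaf per copy and one branch vertex. At [(i0, j0)] it takes the sibling of the
   exceptional leaf, which then vanishes by its own equation; with both leaves zero, [Tw (i0, j0)]
   forces [Tv k i0]. *)
pose g p := if p == (i0, j0) then rev_ord l0 else ord0 : 'I_2.
pose i1 := lift i0 (ord0 : 'I_2).
pose Z := Tv k i1 ::
  [seq Tx (p, g p) | p <- enum (('I_3 * 'I_k)%type : finType)].
suff : (\rank (eigenspace B a) <= size Z)%N.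
  by rewrite /= size_map -cardE card_prod !card_ord leqNgt -addn1 rk.
apply: rank_eigenspace_forcing => f hf fZ.
have fx p : f (Tx (p, g p)) = 0.
  apply: fZ; rewrite inE; apply/orP; right; apply/mapP.
  by exists p; rewrite ?mem_enum.
have fw p : f (Tw p) = 0 := force_w_of_x hf (fx p).
have f1 : f (Tv k i1) = 0 by apply: fZ; rewrite mem_head.
apply: (eigenfun_eq0_of_w hf (neq_lift _ _) fw _ _ f1) => [p|].
  by exists (g p).
have fx0 : f (Tx (i0, j0, l0)) = 0.
  apply: (eigenfun_force_self hB hf) => //.
  by move=> [[[]|i']|[p'|q]] //= _; apply: fw.
apply: (force_v_of_w hf (fw (i0, j0))) => l.
have [->//|ll0] := eqVneq l l0.
suff -> : l = g (i0, j0) by [].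
rewrite /g eqxx; apply: val_inj; move: ll0; rewrite -val_eqE /=.
move: (ltn_ord l) (ltn_ord l0); lia.
Qed.

Lemma branch_diag (a : R) :
  (3 * k + 1 < \rank (eigenspace B a))%N ->
  forall i, b (Tv k i) (Tv k i) = a.
Proof.
move=> rk i0; apply/eqP/contraT => va.
pose i1 := lift i0 (ord0 : 'I_2).
pose Z := Tv k i1 ::
  [seq Tx (p, ord0) | p <- enum (('I_3 * 'I_k)%type : finType)].
suff : (\rank (eigenspace B a) <= size Z)%N.
  by rewrite /= size_map -cardE card_prod !card_ord leqNgt -addn1 rk.
apply: rank_eigenspace_forcing => f hf fZ.
have fx p : f (Tx (p, ord0)) = 0.
  apply: fZ; rewrite inE; apply/orP; right; apply/mapP.
  by exists p; rewrite ?mem_enum.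
have fw p : f (Tw p) = 0 := force_w_of_x hf (fx p).
have f1 : f (Tv k i1) = 0 by apply: fZ; rewrite mem_head.
apply: (eigenfun_eq0_of_w hf (neq_lift _ _) fw _ _ f1) => [p|].
  by exists ord0.
(* All neighbours of [Tv k i0] vanish, the centre being forced by [Tv k i1], so the entry different
   from [a] supplies the second branch vertex. *)
apply: (eigenfun_force_self hB hf) => //.
move=> [[[]|i']|[p'|q]] //=; rewrite /T_edge /= ?orbF // => _.
  by apply: (force_c_of_v hf f1) => j; apply: fw.
exact: fw.
Qed.

(* Eliminating the two leaves of a copy (all leaf entries being l) leaves this
   scalar as the reduced diagonal entry of a - B at its centre p. *)
Definition branch_char (l a : R) (p : 'I_3 * 'I_k) : R :=
  a - b (Tw p) (Tw p) -
  (\sum_l' b (Tw p) (Tx (p, l')) * b (Tx (p, l')) (Tw p)) / (a - l).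

(** * Eigenvalues other than the common leaf entry *)

Section LeafEliminated.

Context (l a : R) (hl : forall q, b (Tx q) (Tx q) = l) (al : a != l).

Let nonedge (u v : T_vertex k) : u != v -> ~~ T_edge u v -> b u v = 0.
Proof. by case: hB => _ h uv; rewrite -h // negbK => /eqP. Qed.

Section Eigenfunction.

Context (f : T_vertex k -> R) (hf : eigenfun B a f).

Lemma leaf_eigen q :
  f (Tx q) = f (Tw q.1) * b (Tw q.1) (Tx q) / (a - l).
Proof.
have al0 : a - l != 0 by rewrite subr_eq0.
apply: (mulIf al0); rewrite mulfVK //.
have := hf (Tx q); rewrite T_sum -!/(b _ _) nonedge // mulr0 add0r.
rewrite big1 ?add0r => [|i _]; last by rewrite -/(b _ _) nonedge ?mulr0.
rewrite (bigD1 q.1) //= big1 ?addr0 => [|p pq]; last first.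
  by rewrite -/(b _ _) nonedge ?mulr0 // /T_edge /= orbF eq_sym.
rewrite (bigD1 q) //= big1 ?addr0 => [|q' qq]; last first.
  by rewrite -/(b _ _) nonedge ?mulr0.
by rewrite -!/(b _ _) hl mulrBr [a * _]mulrC => <-; rewrite addrK.
Qed.

(** The equation at [Tw p] after substituting [leaf_eigen] for both leaves. *)
Lemma branch_eigen p :
  f (Tv k p.1) * b (Tv k p.1) (Tw p) = branch_char l a p * f (Tw p).
Proof.
have := hf (Tw p); rewrite T_sum -!/(b _ _) nonedge // mulr0 add0r.
rewrite (bigD1 p.1) //= big1 ?addr0 => [|i ip]; last first.
  by rewrite -/(b _ _) nonedge ?mulr0 // /T_edge /= orbF eq_sym.
rewrite (bigD1 p) //= big1 ?addr0 => [|p' pp]; last first.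
  by rewrite -/(b _ _) nonedge ?mulr0.
have -> : \sum_q f (Tx q) * B (enum_rank (Tx q)) (enum_rank (Tw p)) =
    \sum_l' f (Tx (p, l')) * b (Tx (p, l')) (Tw p).
  pose F p' l' := f (Tx (p', l')) * b (Tx (p', l')) (Tw p).
  rewrite [LHS](eq_bigr (fun q => F q.1 q.2)) => [|[] //].
  rewrite -(pair_bigA _ F) (bigD1 p) //= [X in _ + X]big1 ?addr0 // => p' pp.
  rewrite big1 // => l' _.
  by rewrite /F nonedge ?mulr0 // /T_edge /=.
rewrite (eq_bigr (fun l' =>
    b (Tw p) (Tx (p, l')) * b (Tx (p, l')) (Tw p) * (f (Tw p) / (a - l)))).
  rewrite -mulr_suml -!/(b _ _) /branch_char => e.
  by rewrite !mulrBl -e; ring.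
by move=> l' _; rewrite leaf_eigen -/(b _ _) /=; ring.
Qed.

Lemma force_v_of_w_ne p : f (Tw p) = 0 -> f (Tv k p.1) = 0.
Proof.
move=> fw; apply: (force_v_of_w hf fw) => l'.
by rewrite leaf_eigen fw !mul0r.
Qed.

(** The two regimes of [branch_eigen]: a zero reduced entry kills the branch vertex outright, while
    a nonzero one lets the branch vertex kill [Tw p]. *)
Lemma force_v_of_char p : branch_char l a p = 0 -> f (Tv k p.1) = 0.
Proof.
move=> P0; apply/eqP; have := branch_eigen p; rewrite P0 mul0r => /eqP.
rewrite mulf_eq0 => /orP[//|]; case: hB => _ h.
by rewrite -[_ == _]negbK /b h // /T_edge /= eqxx.
Qed.

Lemma force_w_of_char p :
  branch_char l a p != 0 -> f (Tv k p.1) = 0 -> f (Tw p) = 0.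
Proof.
move=> P0 fv; apply/eqP; have := branch_eigen p; rewrite fv mul0r => /esym/eqP.
by rewrite mulf_eq0 (negPf P0).
Qed.

Lemma eigenfun_eq0_ne j1 :
    f (Tc k) = 0 -> (forall i, f (Tv k i) = 0) ->
    (forall i j, j != j1 -> f (Tw (i, j)) = 0) ->
  forall v, f v = 0.
Proof.
move=> fc fv fw.
have fw' p : f (Tw p) = 0.
  case: p => i j; have [->|/fw//] := eqVneq j j1.
  by apply: (force_w_of_v hf (fv i) fc) => j'; apply: fw.
case=> [[[]|i]|[p|q]] //; first exact: fv; first exact: fw'.
by rewrite -/(Tx q) leaf_eigen fw' !mul0r.
Qed.

End Eigenfunction.

Context (hk : (3 <= k)%N).

Let other_j (j1 : 'I_k) : {j | j != j1}.
Proof.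
have k1 : (0 < k.-1)%N by move: hk; lia.
by exists (lift j1 (Ordinal k1)); rewrite eq_sym neq_lift.
Qed.

Let force_c_of_v_ne f :
  eigenfun B a f -> b (Tc k) (Tc k) != a -> (forall i, f (Tv k i) = 0) ->
  f (Tc k) = 0.
Proof.
move=> hf ca fv; apply: (eigenfun_force_self hB hf) => //.
by move=> [[[]|i']|[p'|q]] //= _; apply: fv.
Qed.

(** Building block of the forcing sets below: each branch of [r] leaves out one copy centre, to be
    forced by its branch vertex. *)
Let ws (r : seq 'I_3) (j1 : 'I_k) : seq (T_vertex k) :=
  [seq Tw (i, lift j1 j) | i <- r, j <- enum 'I_k.-1].

Let mem_ws r j1 i j : i \in r -> j != j1 -> Tw (i, j) \in ws r j1.
Proof.
move=> ir jj; apply/allpairsP; case: (unliftP j1 j) jj => [j'|] ->.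
  by exists (i, j'); rewrite mem_enum.
by rewrite eqxx.
Qed.

Let size_ws r j1 : size (ws r j1) = (size r * k.-1)%N.
Proof. by rewrite size_allpairs size_enum_ord. Qed.

(** The [3 * (k - 1)] vertices of [ws] kill all [Tv], then the centre by its own equation, then the
    omitted [Tw]. *)
Lemma rank_eigenspace_center :
  b (Tc k) (Tc k) != a -> (\rank (eigenspace B a) <= 3 * k - 3)%N.
Proof.
move=> ca; have j1 : 'I_k by apply: (Ordinal (n := k) (m := 0)); move: hk; lia.
apply: (leq_trans (n := size (ws (enum 'I_3) j1))); last first.
  by rewrite size_ws size_enum_ord; lia.
apply: rank_eigenspace_forcing => f hf fZ.
have fw i j : j != j1 -> f (Tw (i, j)) = 0.
  by move=> jj; apply: fZ; rewrite mem_ws ?mem_enum.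
have fv i : f (Tv k i) = 0.
  by have [j jj] := other_j j1; apply: (force_v_of_w_ne hf (fw i j jj)).
by apply: (eigenfun_eq0_ne hf _ fv fw); apply: force_c_of_v_ne.
Qed.

(** A nonzero reduced entry would give a forcing set smaller than the rank. The boolean accounts for
    a centre with entry [a], which its own equation no longer kills. *)
Lemma branch_char_eq0 :
    (3 * k - 3 + (b (Tc k) (Tc k) == a) <= \rank (eigenspace B a))%N ->
  forall p, branch_char l a p = 0.
Proof.
move=> rk [i0 j0]; apply/eqP/contraT => P0.
have [j1 P1|allP] := pickP (fun j => branch_char l a (i0, j) == 0).
  have j01 : j0 != j1 by apply: contraNneq P0 => ->.
  pose Z := (if b (Tc k) (Tc k) == a then [:: Tc k] else [::]) ++
    rem (Tw (i0, j0)) (ws (enum 'I_3) j1).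
  have w0 : Tw (i0, j0) \in ws (enum 'I_3) j1 by rewrite mem_ws ?mem_enum.
  suff : (\rank (eigenspace B a) <= size Z)%N.
    move/(leq_trans rk); rewrite /Z size_cat size_rem // size_ws size_enum_ord.
    by case: ifP => _ /=; lia.
  apply: rank_eigenspace_forcing => f hf fZ.
  have fv0 : f (Tv k i0) = 0 by apply: (force_v_of_char hf (eqP P1)).
  have fw i j : j != j1 -> f (Tw (i, j)) = 0.
    move=> jj; have : Tw (i, j) \in ws (enum 'I_3) j1.
      by rewrite mem_ws ?mem_enum.
    rewrite (perm_mem (perm_to_rem w0)) inE => /orP[/eqP->|wZ].
      exact: (force_w_of_char hf P0).
    by apply: fZ; rewrite mem_cat wZ orbT.
  have fv i : f (Tv k i) = 0.
    by have [j jj] := other_j j1; apply: (force_v_of_w_ne hf (fw i j jj)).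
  apply: (eigenfun_eq0_ne hf _ fv fw).
  have [ca|ca] := eqVneq (b (Tc k) (Tc k)) a; last exact: force_c_of_v_ne.
  by apply: fZ; rewrite mem_cat ca eqxx mem_head.
(* With no zero on branch [i0], the vertex [Tv k i0] alone kills the whole branch and the centre.
   The set has [1 + 2 * (k - 1)] elements, fewer than [3 * k - 3] exactly when [k >= 3]. *)
pose Z := Tv k i0 :: ws [seq lift i0 i | i <- enum 'I_2] j0.
suff : (\rank (eigenspace B a) <= size Z)%N.
  move/(leq_trans rk); rewrite /= size_ws size_map size_enum_ord.
  by move: hk; clear; case: (_ == _) => /=; lia.
apply: rank_eigenspace_forcing => f hf fZ.
have fv0 : f (Tv k i0) = 0 by apply: fZ; rewrite mem_head.
have fw0 j : f (Tw (i0, j)) = 0 by apply: (force_w_of_char hf); rewrite ?allP.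
have fc : f (Tc k) = 0 by apply: (force_c_of_v hf fv0).
have fw i j : j != j0 -> f (Tw (i, j)) = 0.
  move=> jj; have [->//|ii] := eqVneq i i0.
  apply: fZ; rewrite inE mem_ws ?orbT //.
  case: (unliftP i0 i) ii => [i'|] ->; last by rewrite eqxx.
  by rewrite map_f // mem_enum.
apply: (eigenfun_eq0_ne hf fc _ fw) => i.
by have [j jj] := other_j j0; apply: (force_v_of_w_ne hf (fw i j jj)).
Qed.

End LeafEliminated.

(* Vieta: a1 and a2 are the roots of x^2 - (w + l) x + w l - s. *)
Lemma branch_center_diag (l a1 a2 : R) p :
    a1 != l -> a2 != l -> a1 != a2 ->
    branch_char l a1 p = 0 -> branch_char l a2 p = 0 ->
  b (Tw p) (Tw p) = a1 + a2 - l.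
Proof.
rewrite /branch_char; set s := \sum_l' _; set w := b _ _ => n1 n2 n12.
have root_eq a : a != l -> a - w - s / (a - l) = 0 -> (a - w) * (a - l) = s.
  by rewrite -subr_eq0 => n /subr0_eq ->; rewrite mulfVK.
move=> /(root_eq _ n1) e1 /(root_eq _ n2) e2.
have n : a1 - a2 != 0 by rewrite subr_eq0.
apply: (mulIf n); apply: subr0_eq; rewrite -[RHS](subrr s) -{1}e2 -e1; ring.
Qed.

Lemma T_trace (c v w x : R) :
    b (Tc k) (Tc k) = c -> (forall i, b (Tv k i) (Tv k i) = v) ->
    (forall p, b (Tw p) (Tw p) = w) -> (forall q, b (Tx q) (Tx q) = x) ->
  \tr B = c + v *+ 3 + (w *+ (3 * k) + x *+ (3 * k * 2)).
Proof.
move=> hc hv hw hx; rewrite /mxtrace (reindex enum_rank) /=; last first.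
  exact/onW_bij/enum_rank_bij.
rewrite T_sum; congr (_ + _ + (_ + _)); first exact: hc.
- by under eq_bigr do rewrite -/(b _ _) hv; rewrite sumr_const card_ord.
- under eq_bigr do rewrite -/(b _ _) hw.
  by rewrite sumr_const card_prod !card_ord.
- under eq_bigr do rewrite -/(b _ _) hx.
  by rewrite sumr_const !card_prod !card_ord.
Qed.

End Tree.

Theorem theorem4p3 (R : realType) (k : nat) (hk : (3 <= k)%N)
    (B : 'M[R]_#|T_vertex k|) (hB : graph_matrix (@T_edge k) B)
    (l1 l2 l3 l4 l5 l6 l7 l8 : R)
    (hl : uniq [:: l1; l2; l3; l4; l5; l6; l7; l8])
    (hspec : has_spectrum B
       [:: (l1, (3 * k + 2)%N); (l2, (3 * k - 2)%N); (l3, (3 * k - 3)%N);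
           (l4, 2%N); (l5, 2%N); (l6, 1%N); (l7, 1%N); (l8, 1%N)]) :
  l1 + 3 * l2 + 3 * l3 = 2 * l4 + 2 * l5 + l6 + l7 + l8.
Proof.
have trB := trace_spectrum _ hspec.
have [n12 n13 n23] : [/\ l2 != l1, l3 != l1 & l2 != l3].
  move: hl => /= /andP[]; rewrite !inE !negb_or => /and3P[n12 n13 _].
  by move=> /andP[/andP[n23 _] _]; split=> //; rewrite eq_sym.
case: hspec => _ _ mults; have [symB _] := hB.
have rk1 : \rank (eigenspace B l1) = (3 * k + 2)%N.
  by rewrite -mup_char_poly_sym // (mults (l1, (3 * k + 2)%N)) ?inE ?eqxx.
have rk2 : \rank (eigenspace B l2) = (3 * k - 2)%N.
  by rewrite -mup_char_poly_sym // (mults (l2, (3 * k - 2)%N)) ?inE ?eqxx ?orbT.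
have rk3 : \rank (eigenspace B l3) = (3 * k - 3)%N.
  by rewrite -mup_char_poly_sym // (mults (l3, (3 * k - 3)%N)) ?inE ?eqxx ?orbT.
have rk1' : (3 * k + 1 < \rank (eigenspace B l1))%N by rewrite rk1; lia.
have hx := leaf_diag hB rk1'; have hv := branch_diag hB rk1'.
have hc : B (enum_rank (Tc k)) (enum_rank (Tc k)) = l2.
  (* Otherwise the multiplicity [3 * k - 2] of [l2] would exceed the bound [3 * k - 3]. *)
  apply/eqP/contraT => c2.
  have := rank_eigenspace_center hB hx n12 hk c2; rewrite rk2; lia.
have P2 := branch_char_eq0 hB hx n12 hk.
have P3 := branch_char_eq0 hB hx n13 hk.
have hw p : B (enum_rank (Tw p)) (enum_rank (Tw p)) = l2 + l3 - l1.
  apply: (branch_center_diag n12 n13 n23); first apply: P2; last apply: P3.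
    by rewrite rk2 hc eqxx; lia.
  by rewrite rk3 hc (negPf n23) addn0.
move: trB; rewrite (T_trace hc hv hw hx) !big_cons !big_nil /= card_T_vertex.
move=> {}trB; have {trB} :
    l2 + l1 *+ 3 + ((l2 + l3 - l1) *+ (3 * k) + l1 *+ (3 * k * 2)) =
    l1 *+ (3 * k + 2) + (l2 *+ (3 * k - 2) + (l3 *+ (3 * k - 3) +
      (l4 *+ 2 + (l5 *+ 2 + (l6 + (l7 + (l8 + 0))))))).
  by apply: trB; lia.
(* These bounds make the natural subtractions exact. The [K]-fold multiples then cancel, since
   [(l2 + l3 - l1) + 2 * l1 = l1 + l2 + l3]. *)
have [k2 k3] : (2 <= 3 * k)%N /\ (3 <= 3 * k)%N by lia.
move: (3 * k)%N k2 k3 => K k2 k3.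
rewrite mulrnA !mulrnBr // mulrnDr mulrnBl !mulrnDl.
by move: (l1 *+ K) (l2 *+ K) (l3 *+ K) => x1 x2 x3 tr; lra.
Qed.
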